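(* For any MeanEstimation algorithm (possibly using shared randomness) in which any machine receives at most $b$ bits in expectation, there is a valid input for which $\mathbb{E}[\|\mathbf{EST}-\boldsymbol\mu\|^2]=\Omega\!\left(y^2\,2^{-3b/d}\right)$.
   Context: MeanEstimation: there are $n$ machines; machine $v$ receives $\mathbf{x}_v\in\mathbb{R}^d$, and all receive a common $y$ with $\|\mathbf{x}_u-\mathbf{x}_v\|\le y$ for all $u,v$. All machines must output the same $\mathbf{EST}\in\mathbb{R}^d$ with $\mathbb{E}[\mathbf{EST}]=\boldsymbol\mu=\frac1n\sum_v\mathbf{x}_v$. $\|\cdot\|$ is a fixed one of the $\ell_1,\ell_2,\ell_\infty$ norms. Algorithms may use a common random string available to all machines. Bits received by a machine count all bits it receives from any source during the algorithm. The hidden constant is absolute. *)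

(* Defs.v *)
From HB Require Import structures.
From mathcomp Require Import all_boot all_order all_algebra.
From mathcomp Require Import all_classical all_reals all_analysis.
Set Implicit Arguments. Unset Strict Implicit. Unset Printing Implicit Defensive.
Import Order.TTheory GRing.Theory Num.Theory.
Local Open Scope ring_scope.

Inductive normKind := L1 | L2 | Linf.

Definition vnorm (R : realType) (k : normKind) (d : nat) (v : 'rV[R]_d) : R :=
  match k with
  | L1 => \sum_(i < d) `|v 0 i|
  | L2 => Num.sqrt (\sum_(i < d) (v 0 i) ^+ 2)
  | Linf => \big[Num.max/0]_(i < d) `|v 0 i|
  end.

(* An input assigns x_v to each machine v : 'I_n; it is valid for y
   when all pairwise distances are at most y. *)
Definition valid_input (R : realType) (k : normKind) (n d : nat) (y : R)
  (x : 'I_n -> 'rV[R]_d) : Prop :=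
  forall u v : 'I_n, vnorm k (x u - x v) <= y.

Definition mean_input (R : realType) (n d : nat) (x : 'I_n -> 'rV[R]_d)
  : 'rV[R]_d :=
  n%:R^-1 *: \sum_(v < n) x v.

(* Main.v *)
Require Import Defs.
From HB Require Import structures.
From mathcomp Require Import all_boot all_order all_algebra.
From mathcomp Require Import all_classical all_reals all_analysis.
From mathcomp Require Import measurable_realfun ring lra.
Import Order.TTheory GRing.Theory Num.Theory.
Local Open Scope ring_scope.

(* Give one machine the input 0 and all the others the same point of an
   M^d grid filling a cube inscribed in the ball of radius y.  Once the random
   string is fixed, the first machine's output depends only on the received
   string; there are fewer than 2^(m+1) strings of length at most m, and each
   output is close to at most 6^d grid points.  With m about 3b/2 and M about
   72 * 2^(3b/(2d)) only a sixth of the grid can be served this way, while by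
   Markov's inequality a third of the grid points on average come with a string
   of length at most m.  Hence a sixth of them are estimated with error at
   least y/(4M).  Counting "close" in the l1 norm, with every norm compared to
   l1 and to the cube, treats the three norms at once. *)

(** * Counting grid points in an l1 ball *)

Lemma normr_natB (R : realDomainType) (i j : nat) :
  `|i%:R - j%:R| = ((i - j) + (j - i))%:R :> R.
Proof.
case: (leqP i j) => [ij|/ltnW ji].
  by rewrite distrC -natrB // ger0_norm // (eqP ij) add0n.
by rewrite -natrB // ger0_norm // (eqP ji) addn0.
Qed.

(** The geometric series on either side of [i] contribute at most 1 each, and the term [j = i] is 1.
    One of the two truncated differences is always 0, so the exponent is the distance. *)
Lemma sum_half_pow_dist (R : realFieldType) (i M : nat) :
  \sum_(j < M) 2^-1 ^+ ((i - j) + (j - i)) <= 3 :> R.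
Proof.
(* Sharpened for induction on [M]: up to [i] the bound doubles with each term, and beyond [i] its
   gap to 3 halves. *)
suff: \sum_(j < M) 2^-1 ^+ ((i - j) + (j - i)) <=
    if (M <= i)%N then 2^-1 ^+ (i - M) else 3 - 2^-1 ^+ (M.-1 - i) :> R.
  have h0 k : 0 <= 2^-1 ^+ k :> R by rewrite exprn_ge0 // invr_ge0.
  have h1 k : 2^-1 ^+ k <= 1 :> R.
    by rewrite exprn_ile1 // ?invr_ge0 // invf_le1 // ler1n.
  move/le_trans; apply; case: ifP => _; first by move: (h1 (i - M)%N); lra.
  by move: (h0 (M.-1 - i)%N); lra.
elim: M => [|M IH]; first by rewrite big_ord0 /= exprn_ge0 // invr_ge0.
rewrite big_ord_recr /=; case: (ltngtP M i) IH => [Mi|iM|->] /= IH.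
- have -> : (M - i = 0)%N by apply/eqP; rewrite subn_eq0 ltnW.
  by move: IH; rewrite addn0 -(subnSK Mi) exprS; lra.
- have -> : (i - M = 0)%N by apply/eqP; rewrite subn_eq0 ltnW.
  rewrite add0n; move: IH; case: M iM => // M iM IH.
  move: IH => /=; rewrite subSn // exprS; lra.
- by rewrite subnn addn0 expr0; move: IH; rewrite subnn expr0; lra.
Qed.

(* Chernoff-style: the indicator of the ball is at most 2^e times the product
   over the coordinates of (1/2)^|z_i - z'_i|. *)
Lemma card_l1_ball (R : realFieldType) (d M e : nat) (z : {ffun 'I_d -> 'I_M}) :
  #|[pred z' : {ffun 'I_d -> 'I_M} |
      (\sum_i ((z i - z' i) + (z' i - z i)) <= e)%N]|%:R
  <= 2 ^+ e * 3 ^+ d :> R.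
Proof.
set A := [pred _ | _].
have h2 : 0 < 2 ^+ e :> R by rewrite exprn_gt0.
rewrite -ler_pdivrMl //.
pose F i j : R := 2^-1 ^+ ((z i - j) + (j - z i)).
have -> : (2 ^+ e)^-1 * #|A|%:R = \sum_(z' in A) 2^-1 ^+ e :> R.
  by rewrite sumr_const -exprVn mulr_natr.
have F0 i j : 0 <= F i j by rewrite exprn_ge0 // invr_ge0.
apply: (@le_trans _ _ (\sum_(z' : {ffun 'I_d -> 'I_M}) \prod_i F i (z' i))).
  rewrite [leRHS](bigID (mem A)) /= ler_wpDr //.
    by apply: sumr_ge0 => z' _; apply: prodr_ge0 => i _.
  apply: ler_sum => z'; rewrite inE => h.
  rewrite /F prodrXr; apply: ler_wiXn2l => //; rewrite ?invr_ge0 //.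
  by rewrite invf_le1 // ler1n.
rewrite -(bigA_distr_bigA (fun i j => F i (nat_of_ord j))) /=.
rewrite -[in leRHS](card_ord d) -prodr_const.
apply: ler_prod => i _; rewrite sum_half_pow_dist andbT.
by apply: sumr_ge0 => j _.
Qed.

(** * Counting points by received string *)

(* The marker [true] makes strings of different lengths stay distinct. *)
Definition pad_string (m : nat) (s : seq bool) : seq bool :=
  s ++ true :: nseq (m - size s) false.

Lemma size_pad_string m s : (size s <= m)%N -> size (pad_string m s) = m.+1.
Proof. by move=> h; rewrite size_cat /= size_nseq addnS subnKC. Qed.

Lemma pad_string_inj m : injective (pad_string m).
Proof.
rewrite /pad_string => s1 s2; move: (m - size s1)%N (m - size s2)%N => a b.
have nf c : true \notin nseq c false by rewrite mem_nseq andbF.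
elim: s1 s2 => [|x s1 IH] [|x' s2] //=.
- by case=> _ h; have := nf a; rewrite h mem_cat inE eqxx orbT.
- by case=> _ h; have := nf b; rewrite -h mem_cat inE eqxx orbT.
- by case=> -> /IH ->.
Qed.

(** Points with the same received string share one estimate; lying within [d / 2] of it, they are
    within [d] of each other, so each string serves at most [2 ^ d * 3 ^ d] of them. *)
Lemma card_near_decodings (R : realFieldType) (d M m : nat)
    (r : {ffun 'I_d -> 'I_M} -> seq bool) (q : seq bool -> 'I_d -> R) :
  #|[pred z : {ffun 'I_d -> 'I_M} | (size (r z) <= m)%N &&
      (\sum_i `|q (r z) i - (z i)%:R| <= d%:R / 2)]|%:R
  <= 2 ^+ m.+1 * 6 ^+ d :> R.
Proof.
set A := [pred _ | _].
(* The default tuple is reached only when [r z] is longer than [m], hence never for [z] in [A]. *)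
pose f z : m.+1.-tuple bool :=
  insubd [tuple of nseq m.+1 true] (pad_string m (r z)).
rewrite -sum1_card (partition_big f xpredT) //= natr_sum.
have -> : 2 ^+ m.+1 * 6 ^+ d = \sum_(t : m.+1.-tuple bool) 6 ^+ d :> R.
  by rewrite sumr_const card_tuple card_bool -natrX mulr_natl.
apply: ler_sum => t _; rewrite sum1_card.
case: (pickP [pred z | (z \in A) && (f z == t)]) => [z0|none]; last first.
  by rewrite (eq_card0 none) exprn_ge0.
rewrite !inE => /andP[/andP[sz0 near0] /eqP ft].
have <- : 2 ^+ d * 3 ^+ d = 6 ^+ d :> R by rewrite -exprMn -natrM.
apply: le_trans _ (card_l1_ball R d M d z0).
rewrite ler_nat; apply/subset_leq_card/fintype.subsetP => z.
rewrite !inE => /andP[/andP[sz near1] /eqP fzt].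
have rz : r z = r z0.
  apply: (@pad_string_inj m).
  have := congr1 val (etrans fzt (esym ft)).
  by rewrite !val_insubd !size_pad_string // eqxx.
rewrite rz in near1.
rewrite -(ler_nat R) natr_sum.
under eq_bigr do rewrite -normr_natB.
apply: (@le_trans _ _
  (\sum_i (`|q (r z0) i - (z0 i)%:R| + `|q (r z0) i - (z i)%:R|))).
  apply: ler_sum => i _.
  rewrite [X in _ <= X + _]distrC -[X in `|X| <= _](subrKA (q (r z0) i)).
  exact: ler_normD.
by rewrite big_split /=; lra.
Qed.

(** * Comparing the three norms *)

(* The [vnorm k]-radius of the cube [-1, 1]^d. *)
Definition cube_radius (R : realType) (k : normKind) (d : nat) : R :=
  match k with L1 => d%:R | L2 => Num.sqrt d%:R | Linf => 1 end.

Lemma cube_radius_gt0 (R : realType) k d : (0 < d)%N -> 0 < cube_radius R k d.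
Proof. by case: k => //= d0; rewrite ?sqrtr_gt0 ltr0n. Qed.

Lemma vnorm_ge0 (R : realType) k d (v : 'rV[R]_d) : 0 <= vnorm k v.
Proof.
case: k => /=; rewrite ?sqrtr_ge0 ?sumr_ge0 //.
by elim/big_rec: _ => // i x _ x0; rewrite le_max x0 orbT.
Qed.

Lemma vnorm_le_cube (R : realType) k d (t : R) (v : 'rV[R]_d) : 0 <= t ->
  (forall i, `|v 0 i| <= t) -> vnorm k v <= cube_radius R k d * t.
Proof.
move=> t0 vt; case: k => /=.
- rewrite mulr_natl -[in leRHS](card_ord d) -sumr_const.
  exact: ler_sum.
- rewrite -[X in _ * X](ger0_norm t0) -sqrtr_sqr -sqrtrM // ler_wsqrtr //.
  rewrite mulr_natl -[in leRHS](card_ord d) -sumr_const.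
  by apply: ler_sum => i _; rewrite -real_normK ?num_real // lerXn2r ?nnegrE.
- rewrite mul1r; elim/big_rec: _ => // i x _ xt.
  by rewrite ge_max vt xt.
Qed.

(** Constant vectors give equality. This is trivial for l1, Cauchy-Schwarz for l2, and a termwise
    bound by the maximum for l-infinity. *)
Lemma l1_le_vnorm (R : realType) k d (v : 'rV[R]_d) : (0 < d)%N ->
  cube_radius R k d * \sum_i `|v 0 i| <= d%:R * vnorm k v.
Proof.
move=> d0; have d0' : 0 < d%:R :> R by rewrite ltr0n.
case: k => //=.
- set S := \sum_i `|v 0 i|; set Q := \sum_i v 0 i ^+ 2.
  have S0 : 0 <= S by apply: sumr_ge0.
  have Q0 : 0 <= Q by apply: sumr_ge0 => i _; rewrite sqr_ge0.
  (* Cauchy-Schwarz, from the nonnegativity of the variance of the |v_i|. *)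
  have SQ : S ^+ 2 <= d%:R * Q.
    have : 0 <= \sum_i (`|v 0 i| - S / d%:R) ^+ 2.
      by apply: sumr_ge0 => i _; rewrite sqr_ge0.
    have -> : \sum_i (`|v 0 i| - S / d%:R) ^+ 2 = Q - S ^+ 2 / d%:R.
      rewrite (eq_bigr (fun i => v 0 i ^+ 2 - S / d%:R * 2 * `|v 0 i|
          + (S / d%:R) ^+ 2)); last first.
        by move=> i _; rewrite -[v 0 i ^+ 2]real_normK ?num_real //; ring.
      rewrite big_split /= sumrB -mulr_sumr sumr_const card_ord.
      by rewrite -/Q -/S -mulr_natr; field; rewrite gt_eqF.
    by rewrite subr_ge0 ler_pdivrMr // mulrC.
  have d2 : d%:R = Num.sqrt d%:R * Num.sqrt d%:R :> R.
    by rewrite -expr2 sqr_sqrtr // ltW.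
  rewrite [X in _ <= X * _]d2 -mulrA ler_wpM2l ?sqrtr_ge0 //.
  by rewrite -(sqrtrM _ (ltW d0')) -[leLHS]ger0_norm // -sqrtr_sqr ler_wsqrtr.
- rewrite mul1r mulr_natl -[X in _ <= _ *+ X](card_ord d) -sumr_const.
  by apply: ler_sum => i _; apply: (le_bigmax _ (fun j => `|v 0 j|) i).
Qed.

(** * Measurability *)

Lemma measurable_fun_countable_comp (R : realType) d (Omega : measurableType d)
    (T : countType) (f : Omega -> T) (g : Omega -> T -> R) :
  (forall s, measurable [set w | f w = s]%classic) ->
  (forall s, measurable_fun setT (g ^~ s)) ->
  measurable_fun setT (fun w => g w (f w)).
Proof.
move=> mf mg _ A mA; rewrite setTI.
have -> : ((fun w => g w (f w)) @^-1` A =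
    \bigcup_s ([set w | f w = s] `&` ((g ^~ s) @^-1` A)))%classic.
  apply/seteqP; split => w /=; first by exists (f w).
  by case=> s _ [/= -> ].
apply: countable_bigcupT_measurable; first exact: countableP.
move=> s; apply: measurableI => //.
by rewrite -[X in measurable X]setTI; exact: mg.
Qed.

Lemma measurable_fun_vnorm_sqr (R : realType) k d dO (Omega : measurableType dO)
    (f : Omega -> 'rV[R]_d) :
  (forall i, measurable_fun setT (fun w => f w 0 i)) ->
  measurable_fun setT (fun w => vnorm k (f w) ^+ 2).
Proof.
move=> mf.
have mn i : measurable_fun setT (fun w => `|f w 0 i|).
  by apply: measurableT_comp => //; exact: normr_measurable.
case: k => /=.
- by apply: measurable_funX; apply: measurable_sum => i; exact: mn.
- under eq_fun do
    (rewrite sqr_sqrtr; last by apply: sumr_ge0 => i _; exact: sqr_ge0).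
  apply: measurable_sum => i; exact: measurable_funX.
- apply: measurable_funX.
  elim: (index_enum _) => [|i s IH].
    by under eq_fun do rewrite big_nil; exact: measurable_cst.
  under eq_fun do rewrite big_cons.
  exact: measurable_maxr.
Qed.

(** * The hard inputs *)

Definition grid_point (R : realType) (d M : nat) (t : R)
  (z : {ffun 'I_d -> 'I_M}) : 'rV[R]_d := \row_i (t * (z i)%:R / M%:R).

Definition grid_input (R : realType) (n d M : nat) (v0 : 'I_n) (t : R)
  (z : {ffun 'I_d -> 'I_M}) (v : 'I_n) : 'rV[R]_d :=
  if v == v0 then 0 else grid_point R d M t z.

(** The two signs are the two orders of subtraction between [v0] and another machine. *)
Lemma vnorm_grid_point (R : realType) k (d M : nat) (y : R)
    (z : {ffun 'I_d -> 'I_M}) : (0 < d)%N -> 0 <= y ->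
  vnorm k (grid_point R d M (y / cube_radius R k d) z) <= y /\
  vnorm k (- grid_point R d M (y / cube_radius R k d) z) <= y.
Proof.
move=> d0 y0; have a0 := cube_radius_gt0 R k d d0.
set t := y / _; have t0 : 0 <= t by rewrite divr_ge0 // ltW.
have -> : y = cube_radius R k d * t by rewrite mulrC divfK // gt_eqF.
have bnd i : `|grid_point R d M t z 0 i| <= t.
  have M0 : (0 < M)%N by apply: leq_ltn_trans (ltn_ord (z i)).
  rewrite mxE ger0_norm; last by rewrite divr_ge0 // mulr_ge0.
  by rewrite ler_pdivrMr ?ltr0n // ler_wpM2l // ler_nat ltnW.
split; apply: vnorm_le_cube => // i.
by rewrite mxE normrN.
Qed.

Lemma valid_grid_input (R : realType) k (n d M : nat) (v0 : 'I_n) (y : R)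
    (z : {ffun 'I_d -> 'I_M}) : (0 < d)%N -> 0 <= y ->
  valid_input k y (grid_input R n d M v0 (y / cube_radius R k d) z).
Proof.
move=> d0 y0; have [h1 h2] := vnorm_grid_point R k d M y z d0 y0.
have h0 : vnorm k (0 : 'rV[R]_d) <= y.
  rewrite (le_trans (@vnorm_le_cube R k d 0 0 _ _)) ?mulr0 //.
  by move=> i; rewrite mxE normr0.
move=> u v; rewrite /grid_input.
by case: ifP => _; case: ifP => _; rewrite ?subr0 ?sub0r ?subrr ?oppr0.
Qed.

Lemma mean_grid_input (R : realType) (n d M : nat) (v0 : 'I_n) (t : R)
    (z : {ffun 'I_d -> 'I_M}) :
  mean_input (grid_input R n d M v0 t z) =
  (n.-1%:R / n%:R) *: grid_point R d M t z.
Proof.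
rewrite /mean_input (bigD1 v0) //= /grid_input eqxx add0r.
rewrite (eq_bigr (fun=> grid_point R d M t z)); last by move=> i /negbTE ->.
rewrite sumr_const cardC1 card_ord.
by rewrite -[_ *+ n.-1]scaler_nat scalerA mulrC.
Qed.

(* Each grid point is either among the few that are well served, or received
   more than [m] bits, or is estimated with error at least [y / (4 * M)]. *)
Lemma grid_count (R : realType) k (n d M m : nat) (v0 : 'I_n) (y : R)
    (r : {ffun 'I_d -> 'I_M} -> seq bool) (o : seq bool -> 'rV[R]_d) :
  (2 <= n)%N -> (0 < d)%N -> (0 < M)%N -> 0 < y ->
  (M ^ d)%:R <= 2 ^+ m.+1 * 6 ^+ d + \sum_z (m.+1%:R^-1 * (size (r z))%:R
    + 16 * M%:R ^+ 2 / y ^+ 2 *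
      vnorm k (o (r z) - mean_input
        (grid_input R n d M v0 (y / cube_radius R k d) z)) ^+ 2).
Proof.
move=> n2 d0 M0 y0; have a0 := cube_radius_gt0 R k d d0.
set a := cube_radius R k d in a0 *; set t := y / a.
have t0 : 0 < t by rewrite divr_gt0.
have M0' : 0 < M%:R :> R by rewrite ltr0n.
have d0' : 0 < d%:R :> R by rewrite ltr0n.
(* The zero input of [v0] shrinks the mean by [al], at least 1/2 since [2 <= n]. *)
set al : R := n.-1%:R / n%:R.
have al2 : 2^-1 <= al.
  case: n n2 @al {v0} => // n n2; rewrite /= ler_pdivlMr ?ltr0n //.
  have : 1 <= n%:R :> R by rewrite ler1n.
  by rewrite -[n.+1%:R]natr1; lra.
have al0 : 0 < al by apply: lt_le_trans al2; rewrite invr_gt0.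
(* The output rescaled so that the exact mean would decode to [z] itself. *)
pose q s i := al^-1 * (M%:R / t) * o s 0 i.
pose A := [pred z | (size (r z) <= m)%N &&
  (\sum_i `|q (r z) i - (z i)%:R| <= d%:R / 2)].
have hA := card_near_decodings R d M m r q; rewrite -/A in hA.
apply: le_trans _ (lerD hA (lexx _)).
(* It suffices to show, for each [z], that 1 is at most the indicator of [A] plus the two costs. *)
rewrite -sum1_card natr_sum big_mkcond /= -big_split /=.
have -> : (M ^ d)%:R = \sum_(z : {ffun 'I_d -> 'I_M}) 1 :> R.
  by rewrite sumr_const card_ffun !card_ord.
apply: ler_sum => z _; rewrite -/t mean_grid_input -/al.
set e := o (r z) - _.
have p1 : 0 <= m.+1%:R^-1 * (size (r z))%:R :> R.
  by rewrite mulr_ge0 // invr_ge0.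
have p2 : 0 <= 16 * M%:R ^+ 2 / y ^+ 2 * vnorm k e ^+ 2.
  by rewrite mulr_ge0 ?sqr_ge0 // divr_ge0 ?sqr_ge0 // mulr_ge0 ?sqr_ge0.
case: ifPn => [_|]; first by rewrite lerDl addr_ge0.
rewrite inE negb_and add0r => /orP[|].
  rewrite -ltnNge => mr; rewrite -[leLHS]addr0 lerD //.
  by rewrite ler_pdivlMl ?ltr0n // mulr1 ler_nat.
rewrite -ltNge => far; rewrite -[leLHS]add0r lerD //.
have eE i : q (r z) i - (z i)%:R = al^-1 * (M%:R / t) * e 0 i.
  rewrite /q /e !mxE; field.
  by rewrite !gt_eqF.
have : d%:R / 2 < al^-1 * (M%:R / t) * \sum_i `|e 0 i|.
  rewrite mulr_sumr; apply: lt_le_trans far _; apply: ler_sum => i _.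
  by rewrite eE normrM ger0_norm // mulr_ge0 ?invr_ge0 ?divr_ge0 // ltW.
move=> {}far; have S0 : 0 <= \sum_i `|e 0 i| by apply: sumr_ge0.
have := l1_le_vnorm R k d e d0; rewrite -/a.
move: far S0; set S := \sum_i _ => far S0 Sv.
have v0' := vnorm_ge0 R k d e; set v := vnorm k e in Sv v0' *.
have {}far : d%:R / 2 < 2 * (M%:R / t) * S.
  apply: lt_le_trans far _; rewrite ler_wpM2r //.
  rewrite ler_wpM2r ?(ltW (divr_gt0 M0' t0)) //.
  by rewrite -[leRHS]invrK lef_pV2 // ?posrE ?invr_gt0.
(* The 4 is 2 from the radius [d / 2] times 2 from [al^-1 <= 2]. *)
have vy : y <= 4 * M%:R * v.
  have : d%:R / 2 * y < 2 * M%:R * (a * S).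
    have -> : 2 * M%:R * (a * S) = 2 * (M%:R / t) * S * y.
      by rewrite /t; field; rewrite !gt_eqF.
    by rewrite ltr_pM2r.
  move=> h; rewrite -(ler_pM2l d0').
  have : 2 * M%:R * (a * S) <= 2 * M%:R * (d%:R * v).
    by rewrite ler_wpM2l // mulr_ge0 // ltW.
  lra.
have -> : 16 * M%:R ^+ 2 / y ^+ 2 * v ^+ 2 = (4 * M%:R * v / y) ^+ 2.
  by field; rewrite gt_eqF.
by rewrite exprn_ege1 // ler_pdivlMr // mul1r.
Qed.

(** * Choice of parameters and averaging *)

(** Here 72 is 12 * 6: [6 ^ d] pays for the ball count, and [12 ^ d >= 12] for the factor 6 and the
    extra 2 in [2 ^+ m.+1]. Since [B >= 1], rounding up keeps [M] below [80 * B]. *)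
Lemma grid_parameters (R : realType) (b : R) (d : nat) : 0 <= b -> (0 < d)%N ->
  exists m M : nat, [/\ (0 < M)%N, b <= 2 / 3 * m.+1%:R,
    6 * (2 ^+ m.+1 * 6 ^+ d) <= (M ^ d)%:R :> R &
    M%:R ^+ 2 * 2 `^ (- (3 * b / d%:R)) <= 80 ^+ 2].
Proof.
move=> b0 d0; have d0' : 0 < d%:R :> R by rewrite ltr0n.
pose B : R := 2 `^ (3 / 2 * b / d%:R).
have c0 : 0 <= 3 / 2 * b by rewrite mulr_ge0.
have B1 : 1 <= B.
  by rewrite -(powRr0 2); apply: ler_powR; rewrite ?ler1n // divr_ge0.
have B0 : 0 < B by apply: lt_le_trans B1.
have /andP[m1 m2] := truncn_itv c0.
have B72 : 0 <= 72 * B by rewrite mulr_ge0 // ltW.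
have /andP[M1 M2] := truncn_itv B72.
exists (Num.truncn (3 / 2 * b)), (Num.truncn (72 * B)).+1.
split => //; first by lra.
- have Bd : B ^+ d = 2 `^ (3 / 2 * b).
    by rewrite -powR_mulrn ?ltW // -powRrM divfK // gt_eqF.
  have h2 : 2 ^+ Num.truncn (3 / 2 * b) <= B ^+ d :> R.
    by rewrite Bd -powR_mulrn //; apply: ler_powR => //; rewrite ler1n.
  have h72 : (72 * B) ^+ d <= (Num.truncn (72 * B)).+1%:R ^+ d.
    by rewrite lerXn2r ?nnegrE ?ltW // mulr_gt0.
  rewrite natrX; apply: le_trans _ h72.
  have h12 : 12 <= 12 ^+ d :> R by rewrite -[leLHS]expr1 ler_weXn2l // ler1n.
  have -> : (72 * B) ^+ d = 12 ^+ d * (6 ^+ d * B ^+ d).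
    by rewrite -!exprMn mulrA -natrM.
  rewrite exprS; apply: (@le_trans _ _ (12 * (6 ^+ d * B ^+ d))).
    have := ler_wpM2l (exprn_ge0 d (ler0n R 6)) h2; lra.
  by rewrite ler_wpM2r // mulr_ge0 // exprn_ge0 // ltW.
- have -> : 2 `^ (- (3 * b / d%:R)) = (B ^+ 2)^-1.
    rewrite powRN -powR_mulrn ?ltW // -powRrM; congr (_ `^ _)^-1.
    by field; rewrite gt_eqF.
  rewrite ler_pdivrMr ?exprn_gt0 // -exprMn lerXn2r ?nnegrE //.
    by rewrite mulr_ge0 // ltW.
  by rewrite -[leLHS]natr1; lra.
Qed.

(** Integrates the pointwise count over the random string. With [F] the received length and [p]
    equal to [m.+1%:R^-1], this contains Markov's inequality. *)
Lemma integral_grid_bound (R : realType) dO (Omega : measurableType dO)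
    (P : probability Omega R) (I : finType) (F G : I -> Omega -> R)
    (N K p p' X X' : R) :
  0 <= N -> 0 <= K -> 0 <= p -> 0 <= p' ->
  (forall z w, 0 <= F z w) -> (forall z w, 0 <= G z w) ->
  (forall z, measurable_fun setT (F z)) ->
  (forall z, measurable_fun setT (G z)) ->
  (forall w, N <= K + \sum_z (p * F z w + p' * G z w)) ->
  (forall z, \int[P]_w (F z w)%:E <= X%:E)%E ->
  (forall z, \int[P]_w (G z w)%:E <= X'%:E)%E ->
  N <= K + #|I|%:R * (p * X + p' * X').
Proof.
move=> N0 K0 p0 p'0 F0 G0 mF mG NFG FX GX.
have H0 z w : 0 <= p * F z w + p' * G z w by rewrite addr_ge0 ?mulr_ge0.
have mH z : measurable_fun setT (fun w => p * F z w + p' * G z w).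
  by apply: measurable_funD; apply: measurable_funM => //; exact: measurable_cst.
have iH z : (\int[P]_w (p * F z w + p' * G z w)%:E <= (p * X + p' * X')%:E)%E.
  under eq_integral do rewrite EFinD !EFinM.
  have mF' : measurable_fun setT (fun w => (F z w)%:E).
    exact/measurable_EFinP.
  have mG' : measurable_fun setT (fun w => (G z w)%:E).
    exact/measurable_EFinP.
  rewrite ge0_integralD //=.
  - rewrite !ge0_integralZl_EFin //=; try by move=> w _; rewrite lee_fin.
    by rewrite EFinD !EFinM leeD // lee_wpmul2l ?lee_fin.
  - by move=> w _; rewrite -EFinM lee_fin mulr_ge0.
  - exact: measurable_funeM.
  - by move=> w _; rewrite -EFinM lee_fin mulr_ge0.
  - exact: measurable_funeM.
rewrite -lee_fin.
have <- : (\int[P]_w (cst N%:E w) = N%:E)%E.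
  by rewrite integral_cst //= probability_setT mule1.
apply: (@le_trans _ _
  (\int[P]_w (K%:E + \sum_z (p * F z w + p' * G z w)%:E))%E).
  apply: ge0_le_integral => //=.
  - apply: emeasurable_funD => //; apply: emeasurable_sum => z.
    exact/measurable_EFinP.
  - by move=> w _; rewrite sumEFin -EFinD lee_fin.
rewrite ge0_integralD //=.
- rewrite integral_cst //= probability_setT mule1 EFinD leeD //.
  rewrite ge0_integral_sum //=.
  + rewrite mulr_natl -sumr_const -sumEFin.
    by apply: lee_sum => z _; exact: iH.
  + by move=> z; apply/measurable_EFinP; exact: mH.
  + by move=> z w _; rewrite lee_fin.
- by move=> w _; apply: sume_ge0 => z _; rewrite lee_fin.
- by apply: emeasurable_sum => z; apply/measurable_EFinP; exact: mH.
Qed.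

(** * The lower bound *)

Theorem theorem6 :
  exists c : rat, 0 < c /\
  forall (R : realType) (n d : nat) (k : normKind) (y b : R)
    (dO : measure_display) (Omega : measurableType dO)
    (P : probability Omega R)
    (recv : 'I_n -> ('I_n -> 'rV[R]_d) -> Omega -> seq bool)
    (out : 'I_n -> 'rV[R]_d -> Omega -> seq bool -> 'rV[R]_d)
    (EST : ('I_n -> 'rV[R]_d) -> Omega -> 'rV[R]_d),
    (2 <= n)%N -> (0 < d)%N -> 0 <= y ->
    (* each machine's output is a function of its own input, the random
       string, and the bit string it received; all machines agree on EST *)
    (forall x, valid_input k y x ->
       forall (v : 'I_n) (w : Omega), EST x w = out v (x v) w (recv v x w)) ->
    (* measurability (hygiene) *)
    (forall x, valid_input k y x -> forall (v : 'I_n) (s : seq bool),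
       measurable [set w | recv v x w = s]) ->
    (forall (v : 'I_n) (a : 'rV[R]_d) (s : seq bool) (i : 'I_d),
       measurable_fun setT (fun w => out v a w s 0 i)) ->
    (* unbiasedness: E[EST] = mu *)
    (forall x, valid_input k y x -> forall i : 'I_d,
       P.-integrable setT (fun w => (EST x w 0 i)%:E) /\
       (\int[P]_w (EST x w 0 i)%:E = (mean_input x 0 i)%:E)%E) ->
    (* every machine receives at most b bits in expectation *)
    (forall x, valid_input k y x -> forall v : 'I_n,
       (\int[P]_w ((size (recv v x w))%:R : R)%:E <= b%:E)%E) ->
    exists x : 'I_n -> 'rV[R]_d, valid_input k y x /\
      (\int[P]_w ((vnorm k (EST x w - mean_input x)) ^+ 2)%:E
         >= (ratr c * y ^+ 2 * (2 `^ (- (3 * b / d%:R))))%:E)%E.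
Proof.
(* The 80 cancels the bound on [M]; the 12 turns the factor 16 of the count into 16/144 = 1/9. *)
exists (((12 * 80)^-1) ^+ 2); split.
  by rewrite exprn_gt0 // invr_gt0 mulr_gt0.
move=> R n d k y b dO Omega P recv out EST n2 d0 y0 hEST mrecv mout _ hb.
pose v0 : 'I_n := Ordinal (ltnW n2).
have val M z := valid_grid_input R k n d M v0 y z d0 y0.
set t := y / _ in val.
(* [b] bounds an expected length on some valid input; a one-point grid supplies one. *)
have b0 : 0 <= b.
  rewrite -lee_fin; apply: le_trans (hb _ (val 1%N [ffun=> ord0]) v0).
  by apply: integral_ge0 => w _; rewrite lee_fin.
move: y0; rewrite le_eqVlt => /orP[/eqP yE|y0].
  exists (grid_input R n d 1 v0 t [ffun=> ord0]); split; first exact: val.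
  rewrite -yE expr0n /= mulr0 mul0r.
  by apply: integral_ge0 => w _; rewrite lee_fin sqr_ge0.
have [m [M [M0 bm KN MB]]] := grid_parameters R b d b0 d0.
(* Otherwise every grid input has expected squared error at most [X], and averaging over the grid is
   contradictory. *)
apply: contrapT => noX.
pose X : R := ratr ((12 * 80)^-1 ^+ 2) * y ^+ 2 * 2 `^ (- (3 * b / d%:R)).
pose x (z : {ffun 'I_d -> 'I_M}) := grid_input R n d M v0 t z.
have hX z :
    (\int[P]_w (vnorm k (EST (x z) w - mean_input (x z)) ^+ 2)%:E <= X%:E)%E.
  rewrite leNgt; apply/negP => lt; apply: noX; exists (x z).
  split; first exact: val.
  exact: ltW.
(* [v0] holds 0 whatever [z] is, so its output depends on [z] only through the received string. *)
have ESTE z w : EST (x z) w = out v0 0 w (recv v0 (x z) w).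
  by rewrite (hEST _ (val _ z) v0) /x /grid_input eqxx.
have K0 : 0 <= 2 ^+ m.+1 * 6 ^+ d :> R by rewrite mulr_ge0 // exprn_ge0.
have q0 : 0 <= 16 * M%:R ^+ 2 / y ^+ 2 :> R.
  by rewrite divr_ge0 ?sqr_ge0 // mulr_ge0 ?sqr_ge0.
have p0 : 0 <= m.+1%:R^-1 :> R by rewrite invr_ge0.
have key : (M ^ d)%:R <= 2 ^+ m.+1 * 6 ^+ d + (M ^ d)%:R *
    (m.+1%:R^-1 * b + 16 * M%:R ^+ 2 / y ^+ 2 * X).
  have cardG : #|{ffun 'I_d -> 'I_M}| = (M ^ d)%N by rewrite card_ffun !card_ord.
  rewrite -[X in _ + X%:R * _]cardG.
  apply: (integral_grid_bound R dO Omega P {ffun 'I_d -> 'I_M}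
    (fun z w => (size (recv v0 (x z) w))%:R)
    (fun z w => vnorm k (EST (x z) w - mean_input (x z)) ^+ 2)) => //.
  - by move=> z w; rewrite sqr_ge0.
  - move=> z; apply: (measurable_fun_countable_comp R _ _ _ (recv v0 (x z))
      (fun=> fun s => (size s)%:R)) => s; first exact: (mrecv _ (val _ z)).
    exact: measurable_cst.
  - move=> z; apply: measurable_fun_vnorm_sqr => i.
    under eq_fun do rewrite mxE ESTE.
    apply: measurable_funD; last first.
      by under eq_fun do rewrite mxE; exact: measurable_cst.
    apply: (measurable_fun_countable_comp R _ _ _ (recv v0 (x z))
      (fun w s => out v0 0 w s 0 i)) => s; first exact: (mrecv _ (val _ z)).
    exact: mout.
  - move=> w; under eq_bigr do rewrite ESTE.
    exact: (grid_count R k n d M m v0 y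
      (fun z => recv v0 (x z) w) (out v0 0 w)).
  - by move=> z; exact: (hb _ (val _ z)).
have N0 : 0 < (M ^ d)%:R :> R by rewrite ltr0n expn_gt0 M0.
have h1 : m.+1%:R^-1 * b <= 2 / 3 by rewrite ler_pdivrMl ?ltr0n // mulrC.
have h2 : 16 * M%:R ^+ 2 / y ^+ 2 * X <= 9^-1.
  move: MB; rewrite /X rmorphXn /= fmorphV rmorphM /= !ratr_nat.
  move: (2 `^ _) => B; have : 0 < 80 :> R by [].
  move: 80 => u u0 MB.
  have -> : 16 * M%:R ^+ 2 / y ^+ 2 * ((12 * u)^-1 ^+ 2 * y ^+ 2 * B) =
      9^-1 * (M%:R ^+ 2 * B / u ^+ 2) by field; rewrite !gt_eqF.
  by rewrite ler_piMr ?invr_ge0 // ler_pdivrMr ?exprn_gt0 // mul1r.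
(* The shares of the grid add up to at most 1/6 + 2/3 + 1/9 = 17/18 < 1. *)
have := ler_wpM2l (ltW N0) (lerD h1 h2).
move: key KN N0; clear; move: (_ * b + _) (2 ^+ _ * _) => pq K; lra.
Qed.
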